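(* Let $R_n$ be any bounded relaxation of $\mathrm{QAP}_n$ (a polytope in $\mathbb{R}^{n^2\times n^2}$ containing $\mathrm{QAP}_n$) such that all inequalities $$\sum_{i,j,k,l\in[n]}n_{ij}n_{kl}Y_{ij,kl}-(2\beta-1)\sum_{i,j\in[n]}n_{ij}Y_{ij,ij}\geqslant\frac14-\left(\beta-\frac12\right)^2,$$ for all $\beta\in\mathbb{Z}$ and all $n_{ij}\in\mathbb{Z}$ ($i,j\in[n]$), are valid for $R_n$. Then $\mathrm{xc}(R_n)\geqslant 2^{\Omega(n)}$.
   Context: $P_\sigma$ is the $n\times n$ permutation matrix of $\sigma\in S_n$ ($P_\sigma(i,j)=1$ iff $\sigma(i)=j$). Matrices in $\mathbb{R}^{n^2\times n^2}$ have rows and columns indexed by pairs $(ij)$, $i,j\in[n]$; $Y_{ij,kl}$ is the entry in row $(ij)$, column $(kl)$. $P^{[2]}_\sigma(ij,kl)=P_\sigma(i,j)P_\sigma(k,l)$ and $\mathrm{QAP}_n=\mathrm{conv}\{P^{[2]}_\sigma:\sigma\in S_n\}$. A polytope $Q\subset\mathbb{R}^{d+r}$ is an extension of a polytope $P\subset\mathbb{R}^d$ if $P=\{x:\exists y,\ (x,y)\in Q\}$; the extension complexity $\mathrm{xc}(P)$ is the minimum number of facets of an extension of $P$. *)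

(* Defs.v *)
From HB Require Import structures.
From mathcomp Require Export all_boot all_order all_fingroup all_algebra.
From mathcomp Require Export all_classical all_reals exp.

Set Implicit Arguments.
Unset Strict Implicit.
Unset Printing Implicit Defensive.

Import Order.TTheory GRing.Theory Num.Theory.

#[global] Open Scope classical_set_scope.
#[global] Open Scope ring_scope.

Section Polytopes.
Variables (R : realType) (V : vectType R).
Implicit Types (S P F : set V).

Definition conv S : set V :=
  [set x | exists (k : nat) (p : 'I_k -> V) (w : 'I_k -> R),
     [/\ forall i, S (p i),
         forall i, 0 <= w i,
         \sum_i w i = 1
       & x = \sum_i w i *: p i]].

Definition polytope P : Prop := exists s : seq V, P = conv [set` s].

Definition face P F : Prop :=
  exists (f : {scalar V}) (b : R),
    (forall x, P x -> f x <= b) /\ F = P `&` [set x | f x = b].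

(* k + 1 affinely independent points in S: x0 and the k elements of s *)
Definition has_affindep S (k : nat) : Prop :=
  exists (x0 : V) (s : seq V),
    [/\ S x0, forall x, x \in s -> S x, size s = k
      & free [seq x - x0 | x <- s]].

Definition has_dim S (k : nat) : Prop :=
  has_affindep S k /\ ~ has_affindep S k.+1.

(* The empty face has no dimension in the sense of has_dim, so a polytope
   reduced to a point has no facet. *)
Definition facet P F : Prop :=
  face P F /\ exists k : nat, has_dim P k.+1 /\ has_dim F k.

Definition nb_facets P (k : nat) : Prop := ([set F | facet P F] #= `I_k)%card.

End Polytopes.

Section ExtensionComplexity.
Variables (R : realType) (V : vectType R).
Implicit Type P : set V.

(* The ambient space R^{d+r} of an extension is V * R^r. *)
Definition extension P (r : nat) (Q : set (V * 'rV[R]_r)%type) : Prop :=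
  polytope Q /\ P = [set x | exists y, Q (x, y)].

Definition extension_sizes P : set nat :=
  [set k | exists (r : nat) (Q : set (V * 'rV[R]_r)%type),
     extension P Q /\ nb_facets Q k].

(* The least element of extension_sizes P; the default 0 is only used when P
   has no extension, hence never for a polytope P. *)
Definition xc P : nat :=
  xget 0%N [set k | extension_sizes P k
                    /\ forall m, extension_sizes P m -> (k <= m)%N].

End ExtensionComplexity.

Section QAP.
Variables (R : realType) (n : nat).

(* Position in [n^2] of the pair (ij). *)
Definition pr (i j : 'I_n) : 'I_(n * n) := mxvec_index i j.

(* mxvec A 0 (pr i j) = A i j, so the entry in row pr i j and column pr k l is
   P_s(i,j) P_s(k,l); and perm_mx s i j = (s i == j)%:R. *)
Definition perm_sq (s : 'S_n) : 'M[R]_(n * n) :=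
  \matrix_(p, q) (mxvec (perm_mx s) 0 p * mxvec (perm_mx s) 0 q).

Definition QAP : set 'M[R]_(n * n) := conv (range perm_sq).

Definition qap_ineq (beta : int) (N : 'I_n -> 'I_n -> int)
    (Y : 'M[R]_(n * n)) : Prop :=
  \sum_(i < n) \sum_(j < n) \sum_(k < n) \sum_(l < n)
      (N i j)%:~R * (N k l)%:~R * Y (pr i j) (pr k l)
  - (2 * beta%:~R - 1)
      * (\sum_(i < n) \sum_(j < n) (N i j)%:~R * Y (pr i j) (pr i j))
  >= 4^-1 - (beta%:~R - 2^-1) ^+ 2.

End QAP.

Arguments perm_sq R n s : clear implicits.
Arguments QAP R n : clear implicits.

(* Main.v *)
From HB Require Import structures.
Require Import Defs.
From mathcomp Require Import zify ring.

Set Implicit Arguments.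
Unset Strict Implicit.
Unset Printing Implicit Defensive.

Import Order.TTheory GRing.Theory Num.Theory.

(** For a permutation s and x = \sum_i N i (s i), the slack of the inequality at the
    vertex of s is (x - beta)(x - (beta - 1)). Let D omit at least two points of [n].
    For b included in D choose s with fixed points exactly b; for a included in D take
    beta = 2 and N i j = 1 if i = j is in a, and 0 otherwise. Then x = #|a :&: b|, so
    the inequality of a is strict at the vertex of b if a and b are disjoint, and tight
    if they meet in exactly one element.

    In an extension Q, a nonempty face and a point outside it are separated by a facet:
    a face that contains the given one, avoids the point and is maximal for these
    properties is a facet, since otherwise its hyperplane could be rotated further. So
    the facets of Q cover the disjoint pairs (a, b), a nonempty, by rectangles, none of
    which contains a pair with #|a :&: b| = 1. By the argument of Kaibel and Weltge such
    a rectangle contains at most 2^#|D| of the 3^#|D| disjoint pairs. *)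

Lemma ratio_test (R : realFieldType) (I : finType) (u h : I -> R) i0 :
  (forall i, 0 <= u i) -> 0 < h i0 ->
  exists i t, [/\ 0 <= t, 0 < h i, u i = t * h i & forall j, t * h j <= u j].
Proof.
move=> u0 hi0.
case: (@Order.TotalTheory.arg_minP _ _ _ i0
  (fun i => 0 < h i) (fun i => u i / h i) hi0) => i hi mini.
exists i, (u i / h i); split=> //; first by rewrite divr_ge0 // ltW.
  by rewrite divfK // gt_eqF.
move=> j; have [hj|hj] := ltP 0 (h j); first by rewrite -ler_pdivlMr // mini.
by apply: le_trans (u0 j); rewrite mulr_ge0_le0 // divr_ge0 // ltW.
Qed.

Lemma separate_vspace (K : fieldType) (V : vectType K) (U : {vspace V}) v :
  v \notin U ->
  exists2 f : {scalar V}, forall u, u \in U -> f u = 0 & f v != 0.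
Proof.
move=> vU; have wU : v - projv U v != 0.
  by apply: contra vU; rewrite subr_eq0 => /eqP->; exact: memv_proj.
have [i wi] : exists i, coord (vbasis fullv) i (v - projv U v) != 0.
  apply/existsP; apply: contra_neqT wU; rewrite negb_exists => /forallP coord0.
  rewrite (coord_vbasis (memvf (v - _))) big1 // => i _.
  by rewrite (eqP (negPn (coord0 i))) scale0r.
exists (coord (vbasis fullv) i \o (\1 - projv U)%VF) => [u uU|] /=.
  by rewrite !lfun_simp projv_id // subrr linear0.
by rewrite !lfun_simp.
Qed.

Section Convexity.
Variables (R : realType) (V : vectType R).
Implicit Types (S P : set V) (f : {scalar V}).

Lemma sub_conv S : S `<=` conv S.
Proof.
move=> x Sx; exists 1%N, (fun=> x), (fun=> 1).
by split=> //; rewrite big_ord1 // scale1r.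
Qed.

Lemma conv_le S f b :
  (forall x, S x -> f x <= b) -> forall x, conv S x -> f x <= b.
Proof.
move=> Sb _ [k [p [w [Sp w0 w1 ->]]]].
rewrite linear_sum -[b]mul1r -w1 mulr_suml.
by apply: ler_sum => i _; rewrite linearZ ler_wpM2l // Sb.
Qed.

Lemma convex_comb_eq_maxP (k : nat) (p : 'I_k -> V) (w : 'I_k -> R) f b :
  (forall i, 0 <= w i) -> \sum_i w i = 1 -> (forall i, f (p i) <= b) ->
  f (\sum_i w i *: p i) = b <-> forall i, w i != 0 -> f (p i) = b.
Proof.
move=> w0 w1 pb.
have defect : b - f (\sum_i w i *: p i) = \sum_i w i * (b - f (p i)).
  under [RHS]eq_bigr do rewrite mulrBr.
  rewrite sumrB -mulr_suml w1 mul1r linear_sum.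
  by congr (_ - _); apply: eq_bigr => i _; rewrite linearZ.
split=> [fb i wi|fb].
  move: defect; rewrite fb subrr => /esym/psumr_eq0P term0.
  have /eqP : w i * (b - f (p i)) = 0.
    by apply: term0 => // j _; rewrite mulr_ge0 // subr_ge0.
  by rewrite mulf_eq0 (negbTE wi) /= subr_eq0 => /eqP.
apply/esym/eqP; rewrite -subr_eq0 defect big1 // => i _.
by have [->|/fb->] := eqVneq (w i) 0; rewrite ?mul0r ?subrr ?mulr0.
Qed.

Lemma conv_image (W : vectType R) (g : {linear V -> W}) S :
  conv (g @` S) = g @` conv S.
Proof.
have g_comb k (w : 'I_k -> R) p :
    g (\sum_i w i *: p i) = \sum_i w i *: g (p i).
  by rewrite linear_sum; apply: eq_bigr => i _; rewrite linearZ.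
apply/seteqP; split=> [_ [k [p [w [Sp w0 w1 ->]]]]|].
  have /choice[q qP] i : exists x, S x /\ g x = p i.
    by have [x] := Sp i; exists x.
  exists (\sum_i w i *: q i); last first.
    by rewrite g_comb; apply: eq_bigr => i _; rewrite (qP i).2.
  by exists k, q, w; split=> // i; exact: (qP i).1.
move=> _ [_ [k [p [w [Sp w0 w1 ->]]]] <-].
by exists k, (g \o p), w; split=> // i; exists (p i).
Qed.

Lemma polytope_image (W : vectType R) (g : {linear V -> W}) P :
  polytope P -> polytope (g @` P).
Proof.
move=> [s ->]; exists (map g s); rewrite -conv_image; congr conv.
apply/seteqP; split=> [_ [x xs <-]|_ /mapP[x xs ->]]; last by exists x.
exact: map_f.
Qed.

End Convexity.

Section Faces.
Variables (R : realType) (V : vectType R).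
Implicit Types (P F G : set V) (f h : {scalar V}) (s : seq V).

Lemma face_sub P F : face P F -> F `<=` P.
Proof. by move=> [f [b [_ ->]]] x []. Qed.

Lemma face_of_lower_bound P f b :
  (forall x, P x -> b <= f x) -> face P (P `&` [set x | f x = b]).
Proof.
move=> fb; exists (\- f), (- b); split=> [x /fb|]; first by rewrite lerN2.
apply/seteqP; split=> x [Px /= fx]; split=> //=; first by rewrite fx.
exact: oppr_inj.
Qed.

Lemma face_preimage (W : vectType R) (Q : set W) (g : {linear W -> V}) P G :
  (forall z, Q z -> P (g z)) -> face P G -> face Q (Q `&` g @^-1` G).
Proof.
move=> QP [f [b [fb ->]]]; exists (f \o g), b; split=> [z /QP/fb//|].
by apply/seteqP; split=> [z [Qz []]|z [Qz fz]]; split=> //; split=> //; exact: QP.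
Qed.

Definition face_trace s F : {set seq_sub s} := [set v | `[< F (val v) >]]%SET.

Lemma face_trace_subset s F G :
  face (conv [set` s]) F -> face (conv [set` s]) G ->
  face_trace s F \subset face_trace s G -> F `<=` G.
Proof.
move=> [f [b [fb FE]]] [g [c [gc GE]]] /fintype.subsetP sFG x.
rewrite {1}FE GE /= => -[Px fx]; split=> //.
case: Px fx => k [p [w [sp w0 w1 ->]]] fx.
have fpb i : f (p i) <= b by exact/fb/sub_conv/sp.
have gpc i : g (p i) <= c by exact/gc/sub_conv/sp.
apply/(convex_comb_eq_maxP w0 w1 gpc) => i wi.
have Fpi : F (p i).
  rewrite FE; split; first exact/sub_conv/sp.
  exact: (convex_comb_eq_maxP w0 w1 fpb).1.
have := sFG (SeqSub (sp i)); rewrite !inE => /(_ Fpi).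
by rewrite GE => -[].
Qed.

Lemma finite_faces P : polytope P -> finite_set [set F | face P F].
Proof.
move=> [s ->]; have : finite_set (face_trace s @` [set F | face (conv [set` s]) F]).
  exact/(sub_finite_set (@subsetT _ _))/finite_finset.
rewrite (eq_finite_set (inj_card_eq _)) // => F G /set_mem faceF /set_mem faceG FG.
by apply/seteqP; split; apply: (@face_trace_subset s); rewrite ?FG.
Qed.

Definition maximal_face_avoiding P x F : Prop :=
  [/\ face P F, ~ F x
    & forall F', face P F' -> F `<=` F' -> ~ F' x -> F' `<=` F].

Lemma maximal_face_avoiding_exists P G x : polytope P -> face P G -> ~ G x ->
  exists2 F, maximal_face_avoiding P x F & G `<=` F.
Proof.
move=> [s ->] faceG nGx.
pose avoiding (t : {set seq_sub s}) :=
  `[< exists F, [/\ face (conv [set` s]) F, ~ F x & face_trace s F = t] >].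
have avoidG : avoiding (face_trace s G) by apply/asboolP; exists G.
have [t /maxsetP[/asboolP[F [faceF nFx <-]] maxF] GF] := maxset_exists avoidG.
exists F; last exact: face_trace_subset GF.
split=> // F' faceF' FF' nF'x; apply: (@face_trace_subset s) => //.
rewrite (maxF (face_trace s F')) //; first by apply/asboolP; exists F'.
by apply/fintype.subsetP => v; rewrite !inE; exact: FF'.
Qed.

(* The hyperplane supporting F is rotated about F, towards p, until it hits a new
   generator of P; it stays away from x because h is constant on F and x. *)
Lemma rotate_face P F h x0 x p : polytope P -> face P F -> ~ F x ->
  (forall y, F y -> h y = h x0) -> F x0 -> P x -> h x = h x0 ->
  P p -> h x0 < h p ->
  exists F', [/\ face P F', F `<=` F', ~ F' x & ~ F' `<=` F].
Proof.
move=> [s PE] [f [b [fb FE]]] nFx hF Fx0 Px hx Pp hp.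
have sP (v : seq_sub s) : P (val v) by rewrite PE; exact/sub_conv/valP.
have [v0 hv0] : exists v : seq_sub s, 0 < h (val v) - h x0.
  apply: contrapT => /forallNP h_le; move: hp; apply/negP; rewrite -leNgt.
  move: Pp; rewrite PE; apply: conv_le => q qs.
  by have /negP := h_le (SeqSub qs); rewrite -leNgt subr_le0.
have slack_ge0 (v : seq_sub s) : 0 <= b - f (val v) by rewrite subr_ge0 fb.
have [v [t [t0 hv tv tmin]]] :=
  ratio_test (h := fun v => h (val v) - h x0) slack_ge0 hv0.
pose f' : {scalar V} := f \+ (h \o *:%R t); pose b' := b + t * h x0.
have f'E y : f' y - b' = t * (h y - h x0) - (b - f y).
  by rewrite /f' /b' /= linearZ /=; ring.
exists (P `&` [set y | f' y = b']); split.
- exists f', b'; split=> // y; rewrite PE; apply: conv_le => q qs.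
  by rewrite -subr_le0 f'E subr_le0; exact: (tmin (SeqSub qs)).
- move=> y Fy; have hy := hF y Fy; move: Fy; rewrite FE => -[Py /= fy]; split=> //.
  by apply/eqP; rewrite -subr_eq0 f'E hy fy !subrr mulr0 subrr.
- move=> [_ /= /eqP]; rewrite -subr_eq0 f'E hx subrr mulr0 sub0r oppr_eq0.
  by rewrite subr_eq0 => /eqP fx; apply: nFx; rewrite FE.
- move=> F'F; have /hF hvx0 : F (val v); last by rewrite hvx0 subrr ltxx in hv.
  by apply: F'F; split=> //; apply/eqP; rewrite -subr_eq0 f'E tv subrr.
Qed.

Lemma maximal_face_scalar_constant P F x x0 h p : polytope P ->
  maximal_face_avoiding P x F -> F x0 -> P x ->
  (forall y, F y -> h y = h x0) -> h x = h x0 -> P p -> h p = h x0.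
Proof.
move=> polyP [faceF nFx maxF] Fx0 Px hF hx Pp.
have no_rotation (g : {scalar V}) : (forall y, F y -> g y = g x0) ->
    g x = g x0 -> g p <= g x0.
  move=> gF gx; rewrite leNgt; apply/negP => gp.
  have [F' [faceF' FF' nF'x]] := rotate_face polyP faceF nFx gF Fx0 Px gx Pp gp.
  by apply; apply: maxF.
apply/eqP; rewrite eq_le no_rotation //= -lerN2.
by apply: (no_rotation (\- h)) => [y /hF /= ->|] //=; rewrite hx.
Qed.

End Faces.

Section AffineDimension.
Variables (R : realType) (V : vectType R).
Implicit Types (S P F G : set V) (s : seq V).

Local Notation directions x0 s := [seq y - x0 | y <- s].

Definition affine_basis S x0 s : Prop :=
  [/\ S x0, forall y, y \in s -> S y, free (directions x0 s)
    & forall y, S y -> y - x0 \in <<directions x0 s>>%VS].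

Lemma affine_basis_exists S : S !=set0 -> exists x0 s, affine_basis S x0 s.
Proof.
move=> [z Sz].
have affindep0 : exists k, `[< has_affindep S k >].
  by exists 0%N; apply/asboolP; exists z, [::]; split=> //=; rewrite nil_free.
have affindep_le k : `[< has_affindep S k >] -> (k <= \dim {:V})%N.
  move=> /asboolP[x0 [s [_ _ <- frees]]].
  by rewrite -(size_map (fun x => x - x0)) -(eqP frees) dimvS // subvf.
case: (ex_maxnP affindep0 affindep_le) => k /asboolP[x0 [s [Sx0 Ss sk frees]]] maxk.
exists x0, s; split=> // y Sy; apply: contraT => y_new.
suff /asboolP/maxk : has_affindep S k.+1 by rewrite ltnn.
exists x0, (y :: s); split=> //= [u||]; last by rewrite free_cons y_new.
  by rewrite inE => /predU1P[->//|/Ss].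
by rewrite sk.
Qed.

Lemma affine_basis_has_dim S x0 s : affine_basis S x0 s -> has_dim S (size s).
Proof.
move=> [Sx0 Ss frees spanS]; split; first by exists x0, s.
move=> [y0 [t [Sy0 St st freet]]].
suff /dimvS : (<<directions y0 t>> <= <<directions x0 s>>)%VS.
  by rewrite (eqP freet) (eqP frees) !size_map st ltnn.
apply/span_subvP => _ /mapP[y yt ->].
have -> : y - y0 = (y - x0) - (y0 - x0) by rewrite opprB addrA subrK.
by rewrite rpredB // spanS //; exact: St.
Qed.

Lemma notin_face_direction P F x0 s x : face P F -> affine_basis F x0 s ->
  P x -> ~ F x -> x - x0 \notin <<directions x0 s>>%VS.
Proof.
move=> [f [b [fb FE]]] [Fx0 Fs _ _] Px; apply: contra_notN => x_dir.
have fF y : F y -> f y = b by rewrite FE => -[].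
have f_shift y : F y -> f (y - x0) = 0 by move=> Fy; rewrite linearB !fF ?subrr.
have fx : f (x - x0) = 0.
  rewrite (coord_span (X := in_tuple _) x_dir) linear_sum big1 // => i _.
  have /(mem_nth 0)/mapP[y ys ->] := ltn_ord i.
  by rewrite linearZ /= f_shift ?mulr0 //; exact: Fs.
by rewrite FE; split=> //=; apply/eqP; rewrite -(fF x0) // -subr_eq0 -linearB fx.
Qed.

Lemma facet_separation P G x : polytope P -> face P G -> G !=set0 ->
  P x -> ~ G x -> exists F, [/\ facet P F, G `<=` F & ~ F x].
Proof.
move=> polyP faceG [z Gz] Px nGx.
have [F maxF GF] := maximal_face_avoiding_exists polyP faceG nGx.
have [faceF nFx _] := maxF; exists F; split=> //; split=> //.
have [x0 [s basisF]] := affine_basis_exists (ex_intro _ z (GF z Gz)).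
exists (size s); split; last exact: affine_basis_has_dim basisF.
suff basisP : affine_basis P x0 (x :: s) by exact: affine_basis_has_dim basisP.
have x_new := notin_face_direction faceF basisF Px nFx.
have [Fx0 Fs frees spanF] := basisF.
split=> /= [|y||p Pp]; first exact: face_sub Fx0.
- by rewrite inE => /predU1P[->//|/Fs/(face_sub faceF)].
- by rewrite free_cons x_new.
apply: contraT => /separate_vspace[h h0 /eqP[]].
have hE y : h (y - x0) = 0 -> h y = h x0.
  by rewrite linearB /= => /eqP; rewrite subr_eq0 => /eqP.
apply/eqP; rewrite linearB subr_eq0; apply/eqP.
apply: (maximal_face_scalar_constant polyP maxF) => // [y Fy|].
  by apply/hE/h0; rewrite span_cons; apply: subvP (spanF y Fy); exact: addvSr.
exact/hE/h0/memv_span/mem_head.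
Qed.

Lemma nb_facets_exists P : polytope P -> exists k, nb_facets P k.
Proof. by move=> /finite_faces; apply: sub_finite_set => F []. Qed.

Lemma nb_facets_enum P k : nb_facets P k ->
  exists e : nat -> set V, forall F, facet P F -> exists i : 'I_k, e i = F.
Proof.
move=> Pk; have : ([set F | facet P F] #<= `I_k)%card.
  by rewrite (card_le_eql Pk) card_lexx.
move=> /pcard_surjP[e eP]; exists e => F /eP[i ik <-].
by exists (Ordinal ik).
Qed.

End AffineDimension.

Section Extensions.
Variables (R : realType) (V : vectType R).
Implicit Types (P G : set V).

Definition trivial_lift (x : V) : V * 'rV[R]_0 := (x, 0).

Fact trivial_lift_is_linear : linear trivial_lift.
Proof. by move=> a x y; congr pair; rewrite /= scaler0 addr0. Qed.

HB.instance Definition _ :=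
  GRing.isLinear.Build R V (V * 'rV[R]_0)%type *:%R trivial_lift
    trivial_lift_is_linear.

Lemma extension_sizes_exists P : polytope P -> exists k, extension_sizes P k.
Proof.
move=> polyP; have polyQ := polytope_image trivial_lift polyP.
have [k Qk] := nb_facets_exists polyQ.
exists k, 0%N, (trivial_lift @` P); split=> //; split=> //.
apply/seteqP; split=> [x Px|x [y [x' Px' [<- _]]] //].
by exists 0, x.
Qed.

Lemma extension_sizes_xc P : polytope P -> extension_sizes P (xc P).
Proof.
move=> /extension_sizes_exists[k Pk].
have size_exists : exists k, `[< extension_sizes P k >] by exists k; apply/asboolP.
have [m /asboolP Pm minm] := ex_minnP size_exists.
suff /(xgetPex 0%N)[] : exists m, extension_sizes P m /\
  forall l, extension_sizes P l -> (m <= l)%N by [].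
by exists m; split=> // l Pl; apply/minm/asboolP.
Qed.

Lemma extension_nonincidence_cover P k : extension_sizes P k ->
  exists (A : 'I_k -> set (set V)) (B : 'I_k -> set V), forall G x,
    face P G -> G !=set0 -> P x -> (~ G x <-> exists i, A i G /\ B i x).
Proof.
move=> [r [Q [[polyQ PE] /nb_facets_enum[e eP]]]].
pose lift G : set (V * 'rV[R]_r)%type := Q `&` fst @^-1` G.
have QP z : Q z -> P z.1 by case: z => x y Qz; rewrite PE; exists y.
have lift_neq0 G : face P G -> G !=set0 -> lift G !=set0.
  move=> /face_sub GP [x Gx]; have := GP x Gx; rewrite PE => -[y Qxy].
  by exists (x, y).
exists (fun i => [set G | lift G `<=` e i]).
exists (fun i => [set x | exists2 y, Q (x, y) & ~ e i (x, y)]).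
move=> G x faceG Gneq0 Px; split=> [nGx|[i [Gi [y Qxy ney]]] Gx]; last first.
  exact/ney/Gi.
have [y Qxy] : exists y, Q (x, y) by rewrite PE in Px.
have nGxy : ~ lift G (x, y) by case.
have [F [facetF GF nFxy]] := facet_separation polyQ
  (face_preimage (g := fst) QP faceG) (lift_neq0 G faceG Gneq0) Qxy nGxy.
have [i eiF] := eP F facetF.
by exists i; rewrite /= eiF; split=> //; exists y.
Qed.

End Extensions.

Section Disjointness.
(* The names and notations of finite sets are shadowed by those of classical sets. *)
Import mathcomp.boot.finset.
Local Open Scope set_scope.
Local Open Scope nat_scope.
Variable T : finType.
Implicit Types (D a b : {set T}) (A B : {set {set T}}).

Definition disjoint_pairs A B : {set {set T} * {set T}} :=
  [set p in setX A B | [disjoint p.1 & p.2]].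

Lemma card_disjoint_pairs_powerset D :
  #|disjoint_pairs (powerset D) (powerset D)| = 3 ^ #|D|.
Proof.
pose color (f : {ffun T -> option bool}) :=
  ([set x | f x == Some true], [set x | f x == Some false]).
have color_inj : injective color.
  move=> f g [/setP fg1 /setP fg0]; apply/ffunP => x.
  by have := fg1 x; have := fg0 x; rewrite !inE; case: (f x) (g x) => [[]|] [[]|].
have -> : 3 = #|{: option bool}| by rewrite card_option card_bool.
rewrite -(card_pffun_on None) -(card_imset _ color_inj); apply: eq_card => -[a b].
apply/idP/imsetP => [|[f /pffun_onP[/fintype.subsetP suppf _] [-> ->]]].
  rewrite !inE /= => /andP[/andP[/fintype.subsetP aD /fintype.subsetP bD]] /pred0P ab.
  pose f := [ffun x =>
    if x \in a then Some true else if x \in b then Some false else None].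
  exists f; last by congr pair; apply/setP => x; have := ab x; rewrite !inE ffunE /=;
    case: (x \in a); case: (x \in b).
  apply/pffun_onP; split=> //; apply/fintype.subsetP => x; rewrite inE ffunE.
  by case: ifP => [/aD//|_]; case: ifP => [/bD//|].
rewrite !inE /=; apply/andP; split.
  by apply/andP; split; apply/fintype.subsetP => x; rewrite inE => /eqP fx;
    apply: suppf; rewrite inE fx.
by apply/pred0P => x; rewrite /= !inE; case: (f x) => [[]|].
Qed.

Definition never_meet_once A B : Prop := {in A & B, forall a b, #|a :&: b| != 1}.

(* The disjoint pairs (a, b), with x not in b, that can be recovered from
   (a :\ x, b): x is in a as soon as x |: a is in A. *)
Definition charged x A B : {set {set T} * {set T}} :=
  [set p in disjoint_pairs A B
    | (x \notin p.2) && ((x |: p.1 \in A) ==> (x \in p.1))].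

Lemma leq_card_charged x A B :
  #|charged x A B| <=
  #|disjoint_pairs [set a :\ x | a in A] [set b in B | x \notin b]|.
Proof.
pose erase (p : {set T} * {set T}) := (p.1 :\ x, p.2).
have memE p : p \in charged x A B -> (x \in p.1) = (x |: p.1 \in A).
  rewrite !inE => /andP[/andP[/andP[pA _] _] /andP[_]].
  by have [xp|_ /negbTE->//] := boolP (x \in p.1); rewrite (setUidPr _) ?sub1set ?pA.
have erase_inj : {in charged x A B &, injective erase}.
  move=> [a b] [a' b'] /memE /= xa /memE /= xa' [aa' ->]; congr pair.
  have xaa' : x |: a = x |: a'.
    by apply/setP => y; have /setP/(_ y) := aa'; rewrite !inE; case: eqP.
  apply/setP => y; have [->|yx] := eqVneq y x; first by rewrite xa xa' xaa'.
  by have /setP/(_ y) := aa'; rewrite !inE yx.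
rewrite -(card_in_imset erase_inj); apply/subset_leq_card/fintype.subsetP.
move=> _ /imsetP[[a b] + ->]; rewrite !inE /=.
move=> /andP[/andP[/andP[aA bB] ab] /andP[xb _]].
rewrite bB xb (disjointWl (subD1set _ _) ab) !andbT; apply/imsetP.
by exists a.
Qed.

(* If neither (a, b) nor (b, a) is charged, then x |: a and x |: b belong to A and B
   and meet exactly in x. *)
Lemma disjoint_pairs_charged x A B : never_meet_once A B ->
  forall a b, (a, b) \in disjoint_pairs A B ->
  ((a, b) \in charged x A B) || ((b, a) \in charged x B A).
Proof.
move=> AB a b; rewrite !inE /= => /andP[/andP[aA bB] ab].
rewrite aA bB ab disjoint_sym ab /=.
have /pred0P/(_ x) /= := ab.
have [_ /= ->|_ _] := boolP (x \in a); first by rewrite implybT.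
have [_|_] := boolP (x \in b); first by rewrite implybT.
rewrite !implybF -negb_and; apply/negP => /andP[xaA xbB].
have := AB _ _ xaA xbB; rewrite -setUIr (disjoint_setI0 ab) setU0 cards1.
by rewrite eqxx.
Qed.

Lemma leq_card_disjoint_pairs D A B :
  {in A, forall a, a \subset D} -> {in B, forall b, b \subset D} ->
  never_meet_once A B ->
  #|disjoint_pairs A B| <= 2 ^ #|D|.
Proof.
elim: {D}#|D| {-2}D (erefl #|D|) A B => [|n IHn] D Dn A B AD BD AB.
  rewrite Dn expn0 -(cards1 (set0 : {set T}, set0 : {set T})).
  apply/subset_leq_card/fintype.subsetP => -[a b]; rewrite !inE /=.
  move=> /andP[/andP[/AD + /BD +] _].
  by rewrite (cards0_eq Dn) !subset0 => /eqP-> /eqP->.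
have /set0Pn[x xD] : D != set0 by rewrite -card_gt0 Dn.
have Dxn : #|D :\ x| = n by have := cardsD1 x D; rewrite xD Dn => -[].
have charged_bound A' B' :
    {in A', forall a, a \subset D} -> {in B', forall b, b \subset D} ->
    never_meet_once A' B' -> #|charged x A' B'| <= 2 ^ n.
  move=> A'D B'D A'B'; apply: leq_trans (leq_card_charged _ _ _) _.
  rewrite -Dxn.
  apply: (IHn (D :\ x)) => // [_ /imsetP[a /A'D aD ->]|b|_ b /imsetP[a aA ->]].
  - exact: setSD.
  - by rewrite inE subsetD1 => /andP[/B'D-> ->].
  rewrite inE setIDAC => /andP[bB xb].
  by rewrite (setDidPl _) ?A'B' // disjoint_sym disjoints1 inE (negbTE xb) andbF.
rewrite Dn expnS mul2n -addnn.
pose swap (p : {set T} * {set T}) := (p.2, p.1).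
apply: (@leq_trans #|charged x A B :|: swap @: charged x B A|).
  apply/subset_leq_card/fintype.subsetP => -[a b] /(disjoint_pairs_charged x AB).
  rewrite in_setU; case/orP => [->//|ba]; apply/orP; right.
  by apply/imsetP; exists (b, a).
apply: leq_trans (leq_card_setU _ _) (leq_add (charged_bound A B AD BD AB) _).
apply: leq_trans (leq_imset_card _ _) (charged_bound B A BD AD _).
by move=> b a bB aA; rewrite setIC; exact: AB.
Qed.

Lemma disjointness_cover_leq D (I : finType) (A B : I -> {set {set T}}) :
  (forall i, never_meet_once (A i) (B i)) ->
  {in powerset D &, forall a b, [disjoint a & b]%B ->
     exists i, (a \in A i) && (b \in B i)} ->
  3 ^ #|D| <= #|I| * 2 ^ #|D|.
Proof.
move=> AB cover; rewrite -card_disjoint_pairs_powerset.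
pose rect i := disjoint_pairs (A i :&: powerset D) (B i :&: powerset D).
apply: (@leq_trans #|\bigcup_i rect i|).
  apply/subset_leq_card/fintype.subsetP => -[a b].
  rewrite !inE /= => /andP[/andP[aD bD] ab].
  have [|||i /andP[ai bi]] := cover a b; rewrite ?powersetE //.
  by apply/bigcupP; exists i; rewrite // !inE /= ai bi aD bD.
rewrite -sum_nat_const; apply: (big_ind2 (fun (X : {set _}) k => #|X| <= k)).
- by rewrite cards0.
- by move=> X k Y l Xk Yl; exact: leq_trans (leq_card_setU X Y) (leq_add Xk Yl).
move=> i _; apply: leq_card_disjoint_pairs => [a|b|a b].
- by rewrite inE powersetE => /andP[].
- by rewrite inE powersetE => /andP[].
by move=> /setIP[ai _] /setIP[bi _]; exact: AB ai bi.
Qed.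

(* The pairs with a empty fill the additional rectangle [set set0] x setT. *)
Lemma nonempty_disjointness_cover_leq D (I : finType) (A B : I -> {set {set T}}) :
  (forall i, never_meet_once (A i) (B i)) ->
  {in powerset D &, forall a b, a != set0 -> [disjoint a & b]%B ->
     exists i, (a \in A i) && (b \in B i)} ->
  3 ^ #|D| <= #|I|.+1 * 2 ^ #|D|.
Proof.
move=> AB cover; rewrite -card_option.
apply: (disjointness_cover_leq (A := oapp A [set set0]) (B := oapp B setT)).
  case=> [i|] a b /=; first exact: AB.
  by rewrite inE => /eqP-> _; rewrite set0I cards0.
move=> a b aD bD ab; have [->|a0] := eqVneq a set0.
  by exists None; rewrite /= !inE eqxx.
by have [i ABi] := cover a b aD bD a0 ab; exists (Some i).
Qed.

End Disjointness.

Lemma unique_disjointness_extension_size (R : realType) (V : vectType R)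
    (T : finType) (D : {set T}) (P : set V) (k : nat)
    (G : {set T} -> set V) (v : {set T} -> V) :
  extension_sizes P k ->
  {in powerset D, forall a, face P (G a)} -> {in powerset D, forall b, P (v b)} ->
  {in powerset D &, forall a b : {set T}, [disjoint a & b]%B -> ~ G a (v b)} ->
  {in powerset D &, forall a b : {set T}, #|(a :&: b)%SET| = 1%N -> G a (v b)} ->
  (3 ^ #|D| <= k.+1 * 2 ^ #|D|)%N.
Proof.
move=> /extension_nonincidence_cover[A [B cover]] faceG Pv outside inside.
have G_neq0 : {in powerset D, forall a : {set T}, a != finset.set0 -> G a !=set0}.
  move=> a aD /finset.set0Pn[x xa]; exists (v [set x]%SET).
  have x_sub_a : [set x]%SET \subset a by rewrite finset.sub1set.
  apply: (inside a _ aD); last by rewrite (finset.setIidPr x_sub_a) cards1.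
  by move: aD; rewrite !powersetE; exact: fintype.subset_trans x_sub_a.
have nonincident : {in powerset D &, forall a b : {set T}, a != finset.set0 ->
    ~ G a (v b) <-> exists i, A i (G a) /\ B i (v b)}.
  by move=> a b aD bD a_neq0; exact: cover (faceG a aD) (G_neq0 a aD a_neq0) (Pv b bD).
rewrite -[k]card_ord; apply: (nonempty_disjointness_cover_leq
  (A := fun i => [set a in powerset D | `[< A i (G a) >]]%SET)
  (B := fun i => [set b in powerset D | `[< B i (v b) >]]%SET)).
  move=> i a b /finset.setIdP[aD /asboolP Aa] /finset.setIdP[bD /asboolP Bb].
  apply/eqP => ab1; have a_neq0 : a != finset.set0.
    by apply: contra_eq_neq ab1 => ->; rewrite finset.set0I cards0.
  have /(nonincident a b aD bD a_neq0) : exists i, A i (G a) /\ B i (v b) by exists i.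
  by apply; exact: inside ab1.
move=> a b aD bD a_neq0 /(outside a b aD bD).
move=> /(nonincident a b aD bD a_neq0)[i [Aa Bb]]; exists i.
by apply/andP; split; apply/finset.setIdP; split=> //; apply/asboolP.
Qed.

Lemma perm_with_fixed_points (T : finType) (b : {set T}) : #|(~: b)%SET| != 1%N ->
  exists s : {perm T}, forall x, (s x == x) = (x \in b).
Proof.
set moved := enum (~: b)%SET => b_neq1.
have uniq_moved : uniq moved by exact: enum_uniq.
exists (perm (can_inj (prev_next uniq_moved))) => x; rewrite permE.
have [xb|xb] := boolP (x \in b).
  by apply/eqP; rewrite next_nth mem_enum !inE xb.
have /rot_to[i t rot_moved] : x \in moved by rewrite mem_enum !inE.
apply/eqP; rewrite -(next_rot i uniq_moved) rot_moved.
have : uniq (x :: t) by rewrite -rot_moved rot_uniq.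
have : size (x :: t) != 1%N by rewrite -rot_moved size_rot -cardE.
case: t {rot_moved} => //= y t _ /andP[+ _].
by rewrite eqxx => /[swap] ->; rewrite mem_head.
Qed.

Section QapInequalities.
Variables (R : realType) (n : nat).
Implicit Types (beta : int) (N : 'I_n -> 'I_n -> int) (Y : 'M[R]_(n * n)).
Implicit Types (s : 'S_n) (a b : {set 'I_n}).

Definition qap_quad N Y : R :=
  \sum_(i < n) \sum_(j < n) \sum_(k < n) \sum_(l < n)
      (N i j)%:~R * (N k l)%:~R * Y (pr i j) (pr k l).

Definition qap_diag N Y : R :=
  \sum_(i < n) \sum_(j < n) (N i j)%:~R * Y (pr i j) (pr i j).

Definition qap_lhs beta N Y : R :=
  qap_quad N Y - (2 * beta%:~R - 1) * qap_diag N Y.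

Definition qap_rhs beta : R := 4^-1 - (beta%:~R - 2^-1) ^+ 2.

Lemma sum_affine_comb (I : finType) (F G H : I -> R) c :
  (forall i, H i = c * F i + G i) -> \sum_i H i = c * \sum_i F i + \sum_i G i.
Proof. by move=> HE; rewrite mulr_sumr -big_split; apply: eq_bigr. Qed.

Fact qap_quad_is_scalar N : scalar (qap_quad N).
Proof. by move=> c Y Z; do 4!apply: sum_affine_comb => ?; rewrite !mxE; ring. Qed.

Fact qap_diag_is_scalar N : scalar (qap_diag N).
Proof. by move=> c Y Z; do 2!apply: sum_affine_comb => ?; rewrite !mxE; ring. Qed.

Fact qap_lhs_is_scalar beta N : scalar (qap_lhs beta N).
Proof.
move=> c Y Z; rewrite /qap_lhs qap_quad_is_scalar qap_diag_is_scalar; ring.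
Qed.

HB.instance Definition _ beta N :=
  GRing.isLinear.Build R 'M[R]_(n * n) R *%R (qap_lhs beta N)
    (qap_lhs_is_scalar beta N).

Definition qap_weight N s : int := \sum_i N i (s i).

Lemma perm_sq_entry s i j k l :
  perm_sq R n s (pr i j) (pr k l) = (s i == j)%:R * (s k == l)%:R.
Proof. by rewrite mxE !mxvecE !mxE. Qed.

Lemma qap_diag_perm_sq N s : qap_diag N (perm_sq R n s) = (qap_weight N s)%:~R.
Proof.
rewrite rmorph_sum; apply: eq_bigr => i _; rewrite (bigD1 (s i)) //= big1.
  by rewrite perm_sq_entry eqxx !mulr1 addr0.
by move=> j /negbTE ji; rewrite perm_sq_entry eq_sym ji !mulr0.
Qed.

Lemma qap_quad_perm_sq N s :
  qap_quad N (perm_sq R n s) = (qap_weight N s)%:~R ^+ 2.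
Proof.
have weightE : (qap_weight N s)%:~R = \sum_i \sum_j (N i j)%:~R * (s i == j)%:R :> R.
  rewrite -qap_diag_perm_sq; apply: eq_bigr => i _; apply: eq_bigr => j _.
  by rewrite perm_sq_entry; case: (_ == _); rewrite ?mulr1 ?mulr0.
rewrite expr2 [X in X * _]weightE mulr_suml; apply: eq_bigr => i _.
rewrite mulr_suml; apply: eq_bigr => j _; rewrite weightE mulr_sumr.
apply: eq_bigr => k _; rewrite mulr_sumr; apply: eq_bigr => l _.
by rewrite perm_sq_entry mulrACA.
Qed.

Lemma qap_lhs_perm_sq beta N s :
  let x : R := (qap_weight N s)%:~R in
  qap_lhs beta N (perm_sq R n s) =
  qap_rhs beta + (x - beta%:~R) * (x - (beta - 1)%:~R).
Proof.
by rewrite /qap_lhs qap_quad_perm_sq qap_diag_perm_sq /qap_rhs rmorphB rmorph1; field.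
Qed.

Definition qap_face (P : set 'M[R]_(n * n)) beta N : set 'M[R]_(n * n) :=
  P `&` [set Y | qap_lhs beta N Y = qap_rhs beta].

Lemma face_qap_face (P : set 'M[R]_(n * n)) beta N :
  (forall Y, P Y -> qap_ineq beta N Y) -> face P (qap_face P beta N).
Proof. exact: (face_of_lower_bound (f := qap_lhs beta N)). Qed.

Lemma qap_face_perm_sq (P : set 'M[R]_(n * n)) beta N s : P (perm_sq R n s) ->
  qap_face P beta N (perm_sq R n s) <-> qap_weight N s \in [:: beta; beta - 1].
Proof.
move=> Ps; transitivity (qap_lhs beta N (perm_sq R n s) = qap_rhs beta).
  by split=> [[]|].
rewrite qap_lhs_perm_sq !inE; set x := qap_weight N s.
have -> : (x == beta) || (x == beta - 1) =
    ((x%:~R - beta%:~R) * (x%:~R - (beta - 1)%:~R) == 0 :> R).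
  by rewrite mulf_eq0 !subr_eq0 !eqr_int.
split=> [rhsE|/eqP->]; last by rewrite addr0.
by apply/eqP/(addrI (qap_rhs beta)); rewrite addr0.
Qed.

Definition diag_indicator a (i j : 'I_n) : int := ((i == j) && (i \in a))%:Z.

Lemma qap_weight_diag_indicator a b s : (forall i, (s i == i) = (i \in b)) ->
  qap_weight (diag_indicator a) s = #|(a :&: b)%SET|.
Proof.
move=> sE; rewrite /qap_weight /diag_indicator -sum1_card.
rewrite -[RHS]natz natr_sum [RHS]big_mkcond; apply: eq_bigr => i _.
by rewrite inE eq_sym sE andbC; case: ifP.
Qed.

Lemma qap_face_incidence (P : set 'M[R]_(n * n)) b :
  QAP R n `<=` P -> #|(~: b)%SET| != 1%N ->
  exists2 Y, P Y & forall a,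
    qap_face P 2 (diag_indicator a) Y <-> #|(a :&: b)%SET| \in [:: 1; 2]%N.
Proof.
move=> QP /perm_with_fixed_points[s sE].
have Ps : P (perm_sq R n s) by apply/QP/sub_conv; exists s.
exists (perm_sq R n s) => // a.
have := qap_face_perm_sq 2 (diag_indicator a) Ps.
by rewrite (qap_weight_diag_indicator a sE) !inE orbC.
Qed.

Lemma qap_extension_size_bound (D : {set 'I_n}) (P : set 'M[R]_(n * n)) k :
  (1 < #|(~: D)%SET|)%N -> QAP R n `<=` P ->
  (forall beta N Y, P Y -> qap_ineq beta N Y) ->
  extension_sizes P k -> (3 ^ #|D| <= k.+1 * 2 ^ #|D|)%N.
Proof.
move=> coD QP ineq sizeP.
have /choice[v vP] b : exists Y, b \subset D -> P Y /\ forall a,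
    qap_face P 2 (diag_indicator a) Y <-> #|(a :&: b)%SET| \in [:: 1; 2]%N.
  have [bD|_] := boolP (b \subset D); last by exists 0.
  have cob : #|(~: b)%SET| != 1%N.
    by rewrite neq_ltn (leq_trans coD) ?orbT // subset_leq_card // finset.setCS.
  by have [Y PY incidence] := qap_face_incidence QP cob; exists Y.
apply: (unique_disjointness_extension_size
  (G := fun a => qap_face P 2 (diag_indicator a)) (v := v)) sizeP _ _ _ _.
- by move=> a _; apply: face_qap_face => Y; exact: ineq.
- by move=> b; rewrite powersetE => /vP[].
- move=> a b _; rewrite powersetE => /vP[_ incidence] ab /incidence.
  by rewrite (disjoint_setI0 ab) cards0.
move=> a b _; rewrite powersetE => /vP[_ incidence] ab1.
by apply/incidence; rewrite ab1.
Qed.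

End QapInequalities.

Lemma exp2_half_leq m : (2 ^ (m./2 + m) <= 3 ^ m)%N.
Proof.
elim/ltn_ind: m => -[|[|m]] // IHm.
by rewrite /= !addSn !addnS !expnS; have := IHm m (ltnW (ltnSn _)); lia.
Qed.

Lemma exp2_leq_of_exp3_leq m k :
  (1 < m)%N -> (3 ^ m <= k.+1 * 2 ^ m)%N -> (2 ^ m./2.-1 <= k)%N.
Proof.
move=> m_gt1 /(leq_trans (exp2_half_leq m)).
rewrite expnD leq_pmul2r ?expn_gt0 //.
have : (0 < m./2)%N by rewrite half_gt0.
case: (m./2) => // h _; have : (0 < 2 ^ h)%N by rewrite expn_gt0.
by rewrite expnS /=; lia.
Qed.

Theorem theorem6 (R : realType) :
  exists (c : R) (n0 : nat), 0 < c /\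
    forall (n : nat) (Rn : set 'M[R]_(n * n)),
      (n0 <= n)%N ->
      polytope Rn ->
      QAP R n `<=` Rn ->
      (forall (beta : int) (N : 'I_n -> 'I_n -> int) (Y : 'M[R]_(n * n)),
         Rn Y -> qap_ineq beta N Y) ->
      2 `^ (c * n%:R) <= (xc Rn)%:R.
Proof.
exists 4^-1, 10%N; split=> [|n Rn n_ge10 polyR QR ineq]; first by rewrite invr_gt0.
case: n => [|[|m]] // in Rn n_ge10 polyR QR ineq *.
have m_gt1 : (1 < m)%N by lia.
pose D := (~: [set ord0; ord_max : 'I_m.+2])%SET.
have coD : (1 < #|(~: D)%SET|)%N by rewrite finset.setCK cards2.
have cardD : #|D| = m by rewrite cardsCs finset.setCK cards2 card_ord subn2.
have := qap_extension_size_bound coD QR ineq (extension_sizes_xc polyR).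
rewrite cardD => /(exp2_leq_of_exp3_leq m_gt1) xc_ge.
apply: (@le_trans _ _ ((2 ^ m./2.-1)%N%:R)); last by rewrite ler_nat.
rewrite natrX -powR_mulrn // ler_powR ?ler1n // mulrC ler_pdivrMr //.
by rewrite -natrM ler_nat; lia.
Qed.
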